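(* Let $p\in(0,1)$ and let $\mu$ be a probability measure on $\mathbb{R}$. Among all $(1-p,p)$ Bernoulli decompositions of $\mu$: (1) The minimal conditional variation $\beta_*(p,\rho)$ is maximized by the `chasing Pac-Men' decomposition $\rho^+$; i.e., for any $(1-p,p)$ Bernoulli decomposition $\rho$ of $\mu$, $$\beta_*(p,\rho)\ \le\ \beta^+(p,\mu):=\operatorname*{ess\,inf}_{t\in(0,1)}\delta_p^+(t)\ =\ \beta_*(p,\rho^+),$$ where the essential infimum (with respect to Lebesgue measure) of $\delta_p^+$ over $(0,1)$ has the same value as $\inf_{t\in(0,1)}\delta_p^+(t)$. (2) The maximal conditional variation $\beta^\#(p,\rho)$ is maximized by the `colliding Pac-Men' decomposition $\rho^-$, for which $\beta^\#(p,\rho^-)$ equals the diameter of the essential support of $\mu$; that is, $\beta^\#(p,\rho)\le\beta^\#(p,\rho^-)=\operatorname{diam}(\operatorname{supp}\mu)$ for every $(1-p,p)$ Bernoulli decomposition $\rho$ of $\mu$.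
   Context: A $(1-p,p)$ Bernoulli decomposition of a probability measure $\mu$ on $\mathbb{R}$ is a probability measure $\rho(dY_1\,dY_2)$ on $\mathbb{R}^2$ whose marginals $\rho_1,\rho_2$ (the laws of the first coordinate $Y_1$ and the second coordinate $Y_2$) satisfy $(1-p)\rho_1+p\,\rho_2=\mu$. For such $\rho$, $\beta^\#(p,\rho)$ and $\beta_*(p,\rho)$ denote, respectively, the essential supremum and the essential infimum of $Y_2-Y_1$ with respect to $\rho$ (the values $\pm\infty$ are allowed). Let $G(t)=\inf\{u\in\mathbb{R}:\mu((-\infty,u])\ge t\}$ for $t\in(0,1)$. With $t$ uniformly distributed in $(0,1)$: - the `chasing Pac-Men' decomposition $\rho^+$ is the joint law of $Y_1(t)=G((1-p)t)$ and $Y_2(t)=G(1-p+pt)$, and $\delta_p^+(t)=G(1-p+pt)-G((1-p)t)$; - the `colliding Pac-Men' decomposition $\rho^-$ is the joint law of $Y_1(t)=G((1-p)t)$ and $Y_2(t)=G(1-pt)$. Both are $(1-p,p)$ Bernoulli decompositions of $\mu$. The diameter of the support may be $+\infty$. *)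

(* Defs.v *)
From HB Require Import structures.
From mathcomp Require Import all_boot all_order all_algebra.
From mathcomp Require Import all_classical all_reals all_analysis.
From mathcomp Require Import measurable_realfun ess_sup_inf.

Set Implicit Arguments.
Unset Strict Implicit.
Unset Printing Implicit Defensive.

Import Order.TTheory GRing.Theory Num.Theory.
Import numFieldNormedType.Exports.

Local Open Scope classical_set_scope.
Local Open Scope ring_scope.

(* The marginals of rho are its images under the two projections; the identity
   (1 - p) rho_1 + p rho_2 = mu is stated on every Borel set. *)
Definition bernoulli_decomposition (R : realType) (p : R)
    (mu : probability (measurableTypeR R) R)
    (rho : probability (measurableTypeR R * measurableTypeR R)%type R) : Prop :=
  forall A : set (measurableTypeR R), measurable A ->
    ((1 - p)%:E * pushforward rho fst A + p%:E * pushforward rho snd A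
      = mu A)%E.

Definition max_variation (R : realType)
    (rho : probability (measurableTypeR R * measurableTypeR R)%type R) : \bar R :=
  ess_sup rho (fun y => (y.2 - y.1 : R)%:E).

Definition min_variation (R : realType)
    (rho : probability (measurableTypeR R * measurableTypeR R)%type R) : \bar R :=
  ess_inf rho (fun y => (y.2 - y.1 : R)%:E).

(* For t in ]0, 1[ the set is nonempty and bounded below, so [inf] is the true
   infimum. Outside ]0, 1[ the value is junk, but with 0 < p < 1 the arguments
   used below leave ]0, 1[ only when the parameter t does, i.e. on a null set. *)
Definition quantile (R : realType) (mu : probability (measurableTypeR R) R)
    (t : R) : R :=
  inf [set u : R | (t%:E <= mu `]-oo, u]%classic)%E].

Definition delta_plus (R : realType) (p : R)
    (mu : probability (measurableTypeR R) R) (t : R) : R :=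
  quantile mu (1 - p + p * t) - quantile mu ((1 - p) * t).

Definition chasing_map (R : realType) (p : R)
    (mu : probability (measurableTypeR R) R) (t : measurableTypeR R) :
    measurableTypeR R * measurableTypeR R :=
  (quantile mu ((1 - p) * t), quantile mu (1 - p + p * t)).

Definition colliding_map (R : realType) (p : R)
    (mu : probability (measurableTypeR R) R) (t : measurableTypeR R) :
    measurableTypeR R * measurableTypeR R :=
  (quantile mu ((1 - p) * t), quantile mu (1 - p * t)).

Section measurability.
Context (R : realType) (p : R) (mu : probability (measurableTypeR R) R).

Let S (t : R) := [set u : R | (t%:E <= mu `]-oo, u]%classic)%E].
Let D := [set t : measurableTypeR R | has_inf (S t)].

Let S_antitone (s t : R) : s <= t -> S t `<=` S s.
Proof. by move=> st u /=; apply: le_trans; rewrite lee_fin. Qed.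

Let D_itv : is_interval D.
Proof.
move=> s t [_ [m sm]] [[v tv] _] w /andP[sw wt]; split.
  by exists v; exact: S_antitone tv.
by exists m => u wu; apply: sm; exact: S_antitone wu.
Qed.

Let quantile_homo (s t : R) : D s -> D t -> s <= t ->
  quantile mu s <= quantile mu t.
Proof.
move=> [_ Ss] [St _] st; apply: lb_le_inf => // u tu.
by apply: ge_inf => //; exact: S_antitone tu.
Qed.


Lemma quantile_measurable :
  measurable_fun [set: measurableTypeR R]
    (quantile mu : measurableTypeR R -> measurableTypeR R).
Proof.
have mD : measurable D by exact: is_interval_measurable.
rewrite -(setUv D); apply/measurable_funU => //; first exact: measurableC.
split.
  apply: (measurability (@RGenCInfty.G R)) => [|/= _ [_] [r] -> <-].
    exact: RGenCInfty.measurableE.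
  apply: is_interval_measurable => s t [Ds rs] [Dt _] u /andP[su ut].
  have Du : D u by apply: D_itv Ds Dt _ _; rewrite su.
  split=> //; move: rs; rewrite /= !in_itv/= !andbT => /le_trans; apply.
  exact: quantile_homo.
apply: (eq_measurable_fun (cst (0 : R) : _ -> measurableTypeR R)) => [t|].
  rewrite inE => nDt; rewrite /quantile inf_out //.
exact: measurable_cst.
Qed.

Lemma chasing_map_measurable :
  measurable_fun [set: measurableTypeR R] (chasing_map p mu).
Proof.
apply: measurable_fun_pair.
  apply: (measurableT_comp quantile_measurable).
  exact: measurable_funM.
apply: (measurableT_comp quantile_measurable).
by apply: measurable_funD => //; exact: measurable_funM.
Qed.

Lemma colliding_map_measurable :
  measurable_fun [set: measurableTypeR R] (colliding_map p mu).
Proof.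
apply: measurable_fun_pair.
  apply: (measurableT_comp quantile_measurable).
  exact: measurable_funM.
apply: (measurableT_comp quantile_measurable).
by apply: measurable_funB => //; exact: measurable_funM.
Qed.

HB.instance Definition _ := isMeasurableFun.Build _ _ _ _ (chasing_map p mu)
  chasing_map_measurable.

HB.instance Definition _ := isMeasurableFun.Build _ _ _ _ (colliding_map p mu)
  colliding_map_measurable.

Definition chasing_decomposition :
    probability (measurableTypeR R * measurableTypeR R)%type R :=
  distribution (uniform_prob (@ltr01 R)) (chasing_map p mu).

Definition colliding_decomposition :
    probability (measurableTypeR R * measurableTypeR R)%type R :=
  distribution (uniform_prob (@ltr01 R)) (colliding_map p mu).

End measurability.

Definition beta_plus (R : realType) (p : R)
    (mu : probability (measurableTypeR R) R) : \bar R :=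
  ess_inf (mrestr (@lebesgue_measure R) (measurable_itv `]0%R, 1%R[))
    (fun t => (delta_plus p mu t)%:E).

(* The topological support: the smallest closed set of full mu-measure. *)
Definition essential_support (R : realType)
    (mu : probability (measurableTypeR R) R) : set R :=
  [set x | forall U : set R, open U -> U x -> (0 < mu U)%E].

Definition diameter (R : realType) (A : set R) : \bar R :=
  ereal_sup [set `|x - y|%:E | x in A & y in A].

(* Main.v *)
(* Let F be the distribution function and G the quantile function of mu, so
   that x < G t iff F x < t for 0 < t < 1. The two Pac-Men laws are Bernoulli
   decompositions because, on a ray ]x, +oo[, both identities reduce to lengths
   of subintervals of ]0, 1[, and rays determine a probability measure.

   (1) Suppose b <= Y2 - Y1 rho-almost surely but b > G(1-p+pt) - G((1-p)t) for
   some t. Put v = G(1-p+pt) and w = v - b < G((1-p)t). The decomposition gives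
   rho(Y1 <= w) <= F w / (1-p) < t and rho(Y2 > v) <= (1 - F v) / p <= 1 - t,
   whereas almost surely Y2 <= v forces Y1 <= w, so that the two probabilities
   add up to at least 1. Hence min_variation rho <= delta_plus t at every t,
   not only almost every t, which closes the circle
     beta_plus <= min_variation rho^+ <= inf delta_plus <= beta_plus.

   (2) Y1 and Y2 lie almost surely in the support of mu, which bounds Y2 - Y1 by
   the diameter. For x, y in the support and e > 0, the colliding law has
   Y2 > x - e and Y1 <= y + e for all small t. *)
Require Import Defs.
From HB Require Import structures.
From mathcomp Require Import all_boot all_order all_algebra.
From mathcomp Require Import all_classical all_reals all_analysis.
From mathcomp Require Import measurable_realfun ess_sup_inf.
From mathcomp Require Import ring lra.

Set Implicit Arguments.
Unset Strict Implicit.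
Unset Printing Implicit Defensive.

Import Order.TTheory GRing.Theory Num.Theory.
Import numFieldNormedType.Exports.

Local Open Scope classical_set_scope.
Local Open Scope ring_scope.

(** * The distribution function and its duality with the quantile function *)

Section distribution_function.
Context (R : realType) (mu : probability (measurableTypeR R) R).

Definition dfun (x : R) : R := fine (mu `]-oo, x]%classic).

Lemma dfunE x : mu `]-oo, x]%classic = (dfun x)%:E.
Proof. by rewrite fineK// fin_num_measure. Qed.

Lemma dfun_ge0 x : 0 <= dfun x.
Proof. by rewrite fine_ge0. Qed.

Lemma dfun_le1 x : dfun x <= 1.
Proof. by rewrite -lee_fin -dfunE probability_le1. Qed.

Lemma dfun_nondecreasing x y : x <= y -> dfun x <= dfun y.
Proof.
move=> xy; rewrite -lee_fin -!dfunE le_measure ?inE//.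
by move=> z /=; rewrite !in_itv/= => /le_trans; apply.
Qed.

Lemma probability_ray x : mu `]x, +oo[%classic = (1 - dfun x)%:E.
Proof. by rewrite -setCitvl probability_setC// dfunE EFinB. Qed.

(** Viewing [mu] as the law of the identity random variable gives [dfun] the limits at infinity and
    the right continuity of a [cdf]. *)
Let idTR : measurableTypeR R -> R := idfun.

#[local] HB.instance Definition _ :=
  @isMeasurableFun.Build _ _ _ _ idTR (@measurable_id _ _ setT).

Let fine_cdfE : fine \o cdf (idTR : {RV mu >-> R}) = dfun.
Proof. by apply/funext => x. Qed.

Lemma dfun_gt_ex t : t < 1 -> exists x, t < dfun x.
Proof.
move=> t1; have /fine_cvg/cvgr_gt/(_ _ t1) := cvg_cdfy1 (idTR : {RV mu >-> R}).
by rewrite fine_cdfE => /filter_ex.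
Qed.

Lemma dfun_lt_ex t : 0 < t -> exists x, dfun x < t.
Proof.
move=> t0; have /fine_cvg/cvgr_lt/(_ _ t0) := cvg_cdfNy0 (idTR : {RV mu >-> R}).
by rewrite fine_cdfE => /filter_ex.
Qed.

Lemma dfun_lt_right x t : dfun x < t -> exists2 y, x < y & dfun y < t.
Proof.
move=> xt; have := @cdf_right_continuous _ _ _ _ (idTR : {RV mu >-> R}) x.
rewrite /= [cdf _ x](_ : _ = (dfun x)%:E); last by rewrite -dfunE.
move=> /fine_cvg/cvgr_lt/(_ _ xt); rewrite fine_cdfE => yt.
near x^'+ => y; exists y; first by near: y; exact: nbhs_right_gt.
by near: y.
Unshelve. all: by end_near. Qed.

(** Right continuity makes the equivalence strict on both sides: if F x < t, then F y < t already
    for some y > x, and by monotonicity y is a lower bound of the set whose infimum is the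
    quantile. *)
Lemma lt_quantile t x : 0 < t < 1 -> (x < quantile mu t) = (dfun x < t).
Proof.
move=> /andP[t0 t1]; rewrite /quantile.
under eq_set do rewrite dfunE lee_fin.
have S0 : [set u | t <= dfun u] !=set0.
  by have [u /ltW tu] := dfun_gt_ex t1; exists u.
have lbS y : dfun y < t -> lbound [set u | t <= dfun u] y.
  move=> yt u /= tu; rewrite leNgt; apply/negP => /ltW/dfun_nondecreasing.
  by rewrite leNgt (lt_le_trans yt tu).
apply/idP/idP => [|/dfun_lt_right[y xy yt]]; last first.
  exact: lt_le_trans xy (lb_le_inf S0 (lbS _ yt)).
apply: contraTT; rewrite -!leNgt => tx; apply: ge_inf => //.
by have [y yt] := dfun_lt_ex t0; exists y; exact: lbS.
Qed.

End distribution_function.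

(** * Uniform law, transfer of almost-sure statements, uniqueness on rays, support *)

Lemma uniform_probE (R : realType) (A : set (measurableTypeR R)) :
  measurable A ->
  uniform_prob (@ltr01 R) A = lebesgue_measure (A `&` `]0, 1[%classic).
Proof.
move=> mA; rewrite /uniform_prob integral_uniform_pdf.
rewrite (eq_integral (cst 1%:E)); last first.
  move=> x /[!inE] -[_]; rewrite /= in_itv/= /uniform_pdf => ->.
  by rewrite subr0 invr1.
rewrite integral_cst/=; last exact: measurableI.
rewrite mul1e; apply/eqP; rewrite eq_le; apply/andP; split; last first.
  apply: le_measure; rewrite ?inE; [exact: measurableI|exact: measurableI|].
  by apply: setIS; apply: subset_itv; rewrite bnd_simp.
(* The uniform density lives on the closed interval; passing to ]0, 1[ loses only the two endpoints,
   a null set. *)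
have sub : A `&` `[0, 1] `<=` (A `&` `]0, 1[%classic) `|` [set 0; 1].
  move=> x [Ax]; rewrite /= !in_itv/= => /andP[x0 x1].
  have [->|nx0] := eqVneq x 0; first by right; left.
  have [->|nx1] := eqVneq x 1; first by right; right.
  by left; split=> //; apply/andP; rewrite !lt_neqAle eq_sym nx0 x0 nx1.
apply: (le_trans (le_measure _ _ _ sub)); rewrite ?inE.
- exact: measurableI.
- by apply: measurableU; [exact: measurableI|exact: measurableU].
apply: (le_trans (measureU2 _ _ _)).
- exact: measurableI.
- exact: measurableU.
rewrite [X in (_ + X)%E](_ : _ = 0%E) ?adde0//.
by apply: countable_lebesgue_measure0; exact: finite_set_countable.
Qed.

Lemma ae_distribution (R : realType) (d d' : measure_display)
    (T : measurableType d) (T' : measurableType d') (P : probability T R)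
    (X : {mfun T >-> T'}) (Q : set T') : measurable Q ->
  (\forall y \ae distribution P X, Q y) <-> (\forall t \ae P, Q (X t)).
Proof.
move=> mQ; rewrite /almost_everywhere/=.
have mC : measurable (~` [set x | Q x]) by exact: measurableC.
rewrite [X in X <-> _](negligibleP _ mC).
have mX : measurable (~` [set t | Q (X t)]).
  by apply: measurableC; exact: measurable_funPTI.
by rewrite [X in _ <-> X](negligibleP _ mX).
Qed.

Lemma ae_distribution_comp (R : realType) (d d' : measure_display)
    (T : measurableType d) (T' : measurableType d') (P : probability T R)
    (X : {mfun T >-> T'}) (Q : set T') :
  (\forall y \ae distribution P X, Q y) -> (\forall t \ae P, Q (X t)).
Proof.
move=> [A [mA A0 QA]]; exists (X @^-1` A); split => //.
  exact: measurable_funPTI.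
by move=> t /QA.
Qed.

Lemma eq_ae_measurable (R : realType) (d : measure_display)
    (T : measurableType d) (m1 m2 : {measure set T -> \bar R}) (Q : set T) :
  (forall A, measurable A -> m1 A = m2 A) ->
  (\forall x \ae m1, Q x) -> (\forall x \ae m2, Q x).
Proof. by move=> m12 [A [mA A0 QA]]; exists A; split => //; rewrite -m12. Qed.

(** Open right rays form a pi-system generating the Borel sets, and the rays [g n] exhaust the line
    with finite mass. *)
Lemma eq_measure_rays (R : realType)
    (m : {measure set (measurableTypeR R) -> \bar R})
    (P : probability (measurableTypeR R) R) :
  (forall x, m `]x, +oo[%classic = P `]x, +oo[%classic) ->
  forall A, measurable A -> m A = P A.
Proof.
move=> mP A mA.
pose g n : set (measurableTypeR R) := `](- n%:R)%R, +oo[%classic.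
apply: (@measure_unique _ R (measurableTypeR R) (@RGenOInfty.G R) g) => //.
- exact: RGenOInfty.measurableE.
- move=> _ _ [x ->] [y ->]; exists (Num.max x y).
  by apply/seteqP; split => z /=; rewrite !in_itv/= !andbT gt_max => /andP.
- by move=> i; exists (- i%:R).
- rewrite -subTset => x _; exists (Num.truncn (- x)).+1 => //.
  by rewrite /g /= in_itv/= andbT ltrNl truncnS_gt.
- by move=> _ [x ->].
- by move=> k; rewrite mP (le_lt_trans (probability_le1 _ _)) ?ltry.
Qed.

(** A point outside the support has a null open neighbourhood, hence lies in a null interval with
    rational endpoints. [F] enumerates these countably many intervals, with [set0] at all other
    codes. *)
Lemma negligible_essential_supportC (R : realType)
    (mu : probability (measurableTypeR R) R) :
  mu.-negligible (~` essential_support mu).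
Proof.
pose J (qr : rat * rat) : set (measurableTypeR R) :=
  `]ratr qr.1, ratr qr.2[%classic.
pose F k : set (measurableTypeR R) :=
  if unpickle k is Some qr then if mu (J qr) == 0%E then J qr else set0
  else set0.
apply: (@negligibleS _ _ _ _ (\bigcup_k F k)); last first.
  apply: negligible_bigcup => k; rewrite /F.
  case: unpickle => [qr|]; last exact: negligible_set0.
  case: eqP => [J0|_]; last exact: negligible_set0.
  by exists (J qr); split => //; exact: measurable_itv.
move=> x /existsNP[U /not_implyP[oU /not_implyP[Ux /negP]]].
rewrite -leNgt measure_le0 => /eqP U0.
have /nbhs_ballP[e /= e0 xeU] := open_nbhs_nbhs (conj oU Ux).
have xe1 : x - e < x by rewrite gtrBl.
have xe2 : x < x + e by rewrite ltrDl.
have [q /[!in_itv]/= /andP[q1 q2]] := rat_in_itvoo xe1.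
have [r /[!in_itv]/= /andP[r1 r2]] := rat_in_itvoo xe2.
have J0 : mu (J (q, r)) = 0%E.
  apply: subset_measure0 U0 => //; first exact: measurable_itv.
    exact: open_measurable.
  move=> z; rewrite /J /= in_itv/= => /andP[z1 z2]; apply: xeU.
  by rewrite /ball/= ltr_distlC; apply/andP; split; lra.
have FE : F (pickle (q, r)) = J (q, r) by rewrite /F pickleK J0 eqxx.
exists (pickle (q, r)); first exact: I.
by rewrite FE /J /= in_itv/= q2.
Qed.

(** * The two Pac-Men laws are Bernoulli decompositions *)

Section pacman.
Context (R : realType) (p : R) (p_gt0 : 0 < p) (p_lt1 : p < 1)
  (mu : probability (measurableTypeR R) R).

Let plane := (measurableTypeR R * measurableTypeR R)%type.

Let q_gt0 : 0 < 1 - p. Proof. by rewrite subr_gt0. Qed.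

Let measurable_fst_preimage (A : set (measurableTypeR R)) :
  measurable A -> measurable (fst @^-1` A : set plane).
Proof.
by move=> mA; rewrite -[X in measurable X]setTI; exact: measurable_fst.
Qed.

Let measurable_snd_preimage (A : set (measurableTypeR R)) :
  measurable A -> measurable (snd @^-1` A : set plane).
Proof.
by move=> mA; rewrite -[X in measurable X]setTI; exact: measurable_snd.
Qed.

Let pt_itv (t : R) : 0 < t < 1 -> 0 < p * t < p.
Proof. by move=> /andP[t0 t1]; rewrite mulr_gt0// gtr_pMr. Qed.

Lemma left_level_itv (t : R) : 0 < t < 1 -> 0 < (1 - p) * t < 1.
Proof.
move=> /[dup] /pt_itv /andP[pt0 ptp] /andP[t0 t1].
by rewrite mulr_gt0//=; lra.
Qed.

Lemma chasing_level_itv (t : R) : 0 < t < 1 -> 0 < 1 - p + p * t < 1.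
Proof.
move: p_lt1 => p1 /pt_itv /andP[pt0 ptp].
by apply/andP; split; lra.
Qed.

Lemma colliding_level_itv (t : R) : 0 < t < 1 -> 0 < 1 - p * t < 1.
Proof.
move: p_lt1 => p1 /pt_itv /andP[pt0 ptp].
by apply/andP; split; lra.
Qed.

(** The weighted sum of the two marginals is itself a measure [m], so agreement with [mu] on rays
    extends to all Borel sets. *)
Lemma bernoulli_decompositionP
    (rho : probability plane R) :
  (forall x : R, ((1 - p)%:E * rho (fst @^-1` `]x, +oo[%classic) +
    p%:E * rho (snd @^-1` `]x, +oo[%classic) = mu `]x, +oo[%classic)%E) ->
  bernoulli_decomposition p mu rho.
Proof.
move=> H A mA.
pose m1 := mscale (NngNum (ltW q_gt0))
  (distribution rho (mfun_Sub (mem_set measurable_fst))).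
pose m2 := mscale (NngNum (ltW p_gt0))
  (distribution rho (mfun_Sub (mem_set measurable_snd))).
pose m := measure_add m1 m2.
have mE B : m B = ((1 - p)%:E * rho (fst @^-1` B) + p%:E * rho (snd @^-1` B))%E.
  exact: measure_addE.
rewrite /pushforward -mE; apply: eq_measure_rays mA => x.
exact: etrans (mE _) (H x).
Qed.

Let left_ray x :
  [set t | x < quantile mu ((1 - p) * t)] `&` `]0, 1[%classic =
  `]dfun mu x / (1 - p), 1[%classic.
Proof.
apply/seteqP; split => t /=; rewrite !in_itv/=.
  case=> + /[dup] t01 /andP[_ ->]; rewrite andbT ltr_pdivrMr// [t * _]mulrC.
  by rewrite lt_quantile ?left_level_itv.
move=> /andP[xt t1].
have t01 : 0 < t < 1.
  by rewrite t1 (le_lt_trans _ xt)// divr_ge0 ?dfun_ge0// ltW.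
split=> //; rewrite lt_quantile ?left_level_itv//.
by move: xt; rewrite ltr_pdivrMr// [t * _]mulrC.
Qed.

(** The clipping at 0 covers F x < 1 - p, where every t in ]0, 1[ qualifies. *)
Let chasing_ray x :
  [set t | x < quantile mu (1 - p + p * t)] `&` `]0, 1[%classic =
  `]Num.max 0 ((dfun mu x - (1 - p)) / p), 1[%classic.
Proof.
apply/seteqP; split => t /=; rewrite !in_itv/= gt_max.
  case=> + /[dup] t01 /andP[-> ->]; rewrite andbT ltr_pdivrMr// [t * _]mulrC.
  by rewrite lt_quantile ?chasing_level_itv// ltrBlDl.
move=> /andP[/andP[t0 xt] t1]; have t01 : 0 < t < 1 by rewrite t0.
split=> //; rewrite lt_quantile ?chasing_level_itv//.
by move: xt; rewrite ltr_pdivrMr// [t * _]mulrC ltrBlDl.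
Qed.

(** The level 1 - pt decreases in t, so here the solutions form an initial interval, clipped at
    1. *)
Let colliding_ray x :
  [set t | x < quantile mu (1 - p * t)] `&` `]0, 1[%classic =
  `]0, Num.min 1 ((1 - dfun mu x) / p)[%classic.
Proof.
apply/seteqP; split => t /=; rewrite !in_itv/= lt_min.
  case=> + /[dup] t01 /andP[-> ->]; rewrite /= ltr_pdivlMr// [t * _]mulrC.
  by rewrite lt_quantile ?colliding_level_itv// ltrBrDl -ltrBrDr.
move=> /and3P[t0 t1 xt]; have t01 : 0 < t < 1 by rewrite t0.
split=> //; rewrite lt_quantile ?colliding_level_itv//.
by move: xt; rewrite ltr_pdivlMr// [t * _]mulrC => xt; lra.
Qed.

Let uniform_ray (Z : {mfun measurableTypeR R >-> measurableTypeR R}) x :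
  uniform_prob (@ltr01 R) (Z @^-1` `]x, +oo[%classic) =
  lebesgue_measure ([set t | x < Z t] `&` `]0, 1[%classic).
Proof.
rewrite uniform_probE; last exact: measurable_funPTI.
by congr (lebesgue_measure (_ `&` _)); apply/seteqP; split => t /=;
  rewrite in_itv/= andbT.
Qed.

Lemma chasing_bernoulli :
  bernoulli_decomposition p mu (chasing_decomposition p mu).
Proof.
have m1 := measurableT_comp measurable_fst (chasing_map_measurable p mu).
have m2 := measurableT_comp measurable_snd (chasing_map_measurable p mu).
apply: bernoulli_decompositionP => x.
rewrite [X in ((1 - p)%:E * X)%E](uniform_ray (mfun_Sub (mem_set m1))).
rewrite [X in (p%:E * X)%E](uniform_ray (mfun_Sub (mem_set m2))).
rewrite [X in ((1 - p)%:E * lebesgue_measure X)%E]left_ray.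
rewrite [X in (p%:E * lebesgue_measure X)%E]chasing_ray.
rewrite probability_ray !lebesgue_measure_itv/= !lte_fin.
have := dfun_le1 mu x; set F := dfun mu x => F1.
(* Below 1 - p the second coordinate contributes its full weight p, and (1 - p - F) + p = 1 - F.
   From 1 - p on, the first interval is empty and the second alone contributes 1 - F. *)
have [Fq|qF] := ltP F (1 - p).
  have d0 : (F - (1 - p)) / p <= 0.
    by rewrite pmulr_lle0 ?invr_gt0// subr_le0 ltW.
  rewrite ltr_pdivrMr// mul1r Fq max_l// ltr01.
  by congr EFin; field; rewrite gt_eqF.
have d0 : 0 <= (F - (1 - p)) / p by rewrite divr_ge0 ?subr_ge0// ltW.
rewrite ltr_pdivrMr// mul1r ltNge qF/= max_r// mule0 add0e.
rewrite ltr_pdivrMr// mul1r; case: ltP => [Fp|pF].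
  by congr EFin; field; rewrite gt_eqF.
have -> : F = 1 by lra.
by rewrite subrr mule0.
Qed.

Lemma colliding_bernoulli :
  bernoulli_decomposition p mu (colliding_decomposition p mu).
Proof.
have m1 := measurableT_comp measurable_fst (colliding_map_measurable p mu).
have m2 := measurableT_comp measurable_snd (colliding_map_measurable p mu).
apply: bernoulli_decompositionP => x.
rewrite [X in ((1 - p)%:E * X)%E](uniform_ray (mfun_Sub (mem_set m1))).
rewrite [X in (p%:E * X)%E](uniform_ray (mfun_Sub (mem_set m2))).
rewrite [X in ((1 - p)%:E * lebesgue_measure X)%E]left_ray.
rewrite [X in (p%:E * lebesgue_measure X)%E]colliding_ray.
rewrite probability_ray !lebesgue_measure_itv/= !lte_fin.
have := dfun_le1 mu x; set F := dfun mu x => F1.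
have [Fq|qF] := ltP F (1 - p).
  have e1 : 1 <= (1 - F) / p by rewrite ler_pdivlMr//; lra.
  rewrite ltr_pdivrMr// mul1r Fq min_l// ltr01.
  by congr EFin; field; rewrite gt_eqF.
have e1 : (1 - F) / p <= 1 by rewrite ler_pdivrMr//; lra.
rewrite ltr_pdivrMr// mul1r ltNge qF/= min_r// mule0 add0e.
case: ltP => [Fp|pF].
  by congr EFin; field; rewrite gt_eqF.
(* The remaining interval is empty only when F reaches 1, where both sides vanish. *)
have -> : F = 1 by move: pF; rewrite pmulr_lle0 ?invr_gt0//; lra.
by rewrite subrr mule0.
Qed.

Lemma bernoulli_fine
    (rho : probability plane R)
    (A : set (measurableTypeR R)) :
  bernoulli_decomposition p mu rho -> measurable A ->
  (1 - p) * fine (rho (fst @^-1` A)) + p * fine (rho (snd @^-1` A)) =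
  fine (mu A).
Proof.
move=> rhoB mA; rewrite -rhoB// /pushforward.
have mfA := measurable_fst_preimage mA; have msA := measurable_snd_preimage mA.
rewrite -[in RHS](@fineK _ (rho (fst @^-1` A))) ?fin_num_measure//.
by rewrite -[in RHS](@fineK _ (rho (snd @^-1` A))) ?fin_num_measure.
Qed.

(** * Minimal variation and the chasing law *)

Lemma min_variation_le_delta
    (rho : probability plane R) (t : R) :
  bernoulli_decomposition p mu rho -> 0 < t < 1 ->
  (min_variation rho <= (delta_plus p mu t)%:E)%E.
Proof.
move=> rhoB t01; apply: ge_ereal_sup => c /= cae.
rewrite leNgt; apply/negP => dc.
(* The almost-sure lower bound [c] may be +oo; a finite [b] is needed to define the threshold
   [w]. *)
have [b db bc] : exists2 b : R, delta_plus p mu t < b & (b%:E <= c)%E.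
  case: c dc {cae} => [r|_|//]; first by rewrite lte_fin => dr; exists r.
  by exists (delta_plus p mu t + 1); rewrite ?ltrDl ?leey.
have [N [mN N0 NP]] := cae.
set v := quantile mu (1 - p + p * t).
pose w := v - b.
have Fw : dfun mu w < (1 - p) * t.
  rewrite -lt_quantile ?left_level_itv// /w ltrBlDr -ltrBlDl.
  exact: db.
have Fv : 1 - p + p * t <= dfun mu v.
  by rewrite leNgt -lt_quantile ?chasing_level_itv// ltxx.
pose A : set plane := fst @^-1` `]-oo, w]%classic.
pose B : set plane := snd @^-1` `]v, +oo[%classic.
have mA : measurable A by exact: measurable_fst_preimage.
have mB : measurable B by exact: measurable_snd_preimage.
have AB1 : 1 <= fine (rho A) + fine (rho B).
  rewrite -lee_fin EFinD !fineK ?fin_num_measure//.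
  rewrite -(probability_setT rho) -[leRHS]adde0 -N0.
  apply: (@le_trans _ _ (rho ((A `|` B) `|` N))).
    have mABN : measurable (A `|` B `|` N).
      by apply: measurableU => //; exact: measurableU.
    apply: le_measure; [exact/mem_set|exact/mem_set|].
    move=> y _; have [yN|yN] := pselect (N y); [by right|left].
    have : (c <= (y.2 - y.1)%:E)%E by apply: contrapT => yc; apply/yN/NP.
    move=> /(le_trans bc); rewrite lee_fin => by12.
    have [yv|vy] := leP y.2 v; [left|right].
      by rewrite /A /= in_itv/= /w; lra.
    by rewrite /B /= in_itv/= vy.
  apply: (le_trans (measureU2 _ _ _)) => //; first exact: measurableU.
  by rewrite leeD2r// measureU2.
have := bernoulli_fine rhoB (measurable_itv `]-oo, w]).
have := bernoulli_fine rhoB (measurable_itv `]v, +oo[).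
rewrite probability_ray dfunE -/A -/B /=.
have : 0 <= fine (rho (snd @^-1` `]-oo, w]%classic)) by rewrite fine_ge0.
have : 0 <= fine (rho (fst @^-1` `]v, +oo[%classic)) by rewrite fine_ge0.
(* Dropping the nonnegative mass of the other marginal from each identity leaves a < t and b' <= 1 -
   t, against a + b' >= 1. *)
move: AB1; set a := fine (rho A); set b' := fine (rho B).
set a' := fine _; set b'' := fine _ => ab a0 b0 e1 e2.
have : (1 - p) * a < (1 - p) * t.
  by apply: le_lt_trans Fw; rewrite -e2 lerDl mulr_ge0// ltW.
rewrite ltr_pM2l// => at'.
have : p * b' <= p * (1 - t).
  by have := mulr_ge0 (ltW q_gt0) a0; lra.
rewrite ler_pM2l// => bt.
by lra.
Qed.

Lemma measurable_variation_ge (c : \bar R) : measurable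
  [set y : plane | (c <= (y.2 - y.1)%:E)%E].
Proof.
have mf : measurable_fun
    [set: plane] (fun y => (y.2 - y.1 : R)%:E).
  by apply/measurable_EFinP; apply: measurable_funB.
rewrite [X in measurable X](_ : _ = setT `&`
  (fun y => (y.2 - y.1 : R)%:E) @^-1` `[c, +oo[%classic).
  by apply: mf => //; exact: emeasurable_itv.
by rewrite setTI; apply/seteqP; split => y /=; rewrite in_itv/= andbT.
Qed.

(** Along [chasing_map] the variation [y.2 - y.1] is [delta_plus] at t, and the uniform law agrees
    on measurable sets with Lebesgue measure restricted to ]0, 1[. *)
Lemma beta_plus_le_chasing :
  (beta_plus p mu <= min_variation (chasing_decomposition p mu))%E.
Proof.
apply/ess_infP.
rewrite ae_distribution; last exact: measurable_variation_ge.
rewrite /=.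
apply: (@eq_ae_measurable _ _ _
  (mrestr lebesgue_measure (measurable_itv `]0%R, 1%R[))).
  by move=> A mA; symmetry; exact: uniform_probE.
exact: ess_inf_le.
Qed.

Lemma inf_delta_le_beta_plus :
  (ereal_inf [set (delta_plus p mu t)%:E | t in [set t : R | (0 < t < 1)%R]] <=
   beta_plus p mu)%E.
Proof.
apply/ess_infP; exists (~` `]0, 1[%classic); split.
- exact: measurableC.
- exact: etrans (congr1 _ (setICl _)) (measure0 _).
- apply: subsetC => t /=; rewrite in_itv/= => t01.
  by apply: ereal_inf_lbound; exists t.
Qed.

(** * Maximal variation and the colliding law *)

Lemma max_variation_le_diameter
    (rho : probability plane R) :
  bernoulli_decomposition p mu rho ->
  (max_variation rho <= diameter (essential_support mu))%E.
Proof.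
move=> rhoB; apply/ess_supP.
have [N [mN N0 NS]] := negligible_essential_supportC mu.
have e := bernoulli_fine rhoB mN.
have mf := measurable_fst_preimage mN; have ms := measurable_snd_preimage mN.
have f0 : 0 <= fine (rho (fst @^-1` N)) by rewrite fine_ge0.
have s0 : 0 <= fine (rho (snd @^-1` N)) by rewrite fine_ge0.
have {}f0 := mulr_ge0 (ltW q_gt0) f0; have {}s0 := mulr_ge0 (ltW p_gt0) s0.
(* A sum of nonnegative terms with positive weights vanishes only termwise, so a [mu]-null set is
   null for each marginal. *)
move: e; rewrite N0 /= => /eqP; rewrite paddr_eq0//.
rewrite !mulf_eq0 (gt_eqF q_gt0) (gt_eqF p_gt0) /= => /andP[/eqP fN /eqP sN].
have {}fN : rho (fst @^-1` N) = 0%E.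
  by rewrite -[LHS]fineK ?fin_num_measure// fN.
have {}sN : rho (snd @^-1` N) = 0%E.
  by rewrite -[LHS]fineK ?fin_num_measure// sN.
apply: (@negligibleS _ _ _ _ (fst @^-1` N `|` snd @^-1` N)); last first.
  by apply: negligibleU; apply/negligibleP.
apply: subsetCl => y /= /not_orP[y1 y2].
apply: (@le_trans _ _ `|y.2 - y.1|%:E); first by rewrite lee_fin ler_norm.
apply: ereal_sup_ubound; exists y.2; first by apply: contrapT => /NS.
by exists y.1 => //; apply: contrapT => /NS.
Qed.

Lemma sub_le_max_variation_colliding (x y : R) :
  essential_support mu x -> essential_support mu y ->
  ((x - y)%:E <= max_variation (colliding_decomposition p mu))%E.
Proof.
move=> Sx Sy; rewrite leNgt; apply/negP => lt_M.
(* The maximal variation could a priori be -oo, so a finite almost-sure upper bound [c] below x - y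
   is chosen. *)
have [c Mc cxy] : exists2 c : R,
    (max_variation (colliding_decomposition p mu) <= c%:E)%E & c < x - y.
  move: lt_M; case: max_variation => [r|//|_].
    by rewrite lte_fin => ?; exists r.
  by exists (x - y - 1); rewrite ?leNye// gtrBl.
(* Half the slack: (x - e) - (y + e) is exactly c. *)
pose e := (x - y - c) / 2.
have e0 : 0 < e by rewrite /e; lra.
have a0 : 0 < dfun mu (y + e).
  have yU : `]-oo, y + e[%classic y by rewrite /= in_itv/= ltrDl.
  rewrite -lte_fin -dfunE.
  apply: (lt_le_trans (Sy _ (interval_open _ _) yU)) => //.
  by apply: le_measure; rewrite ?inE//; apply: subset_itvl; rewrite bnd_simp.
have b1 : 0 < 1 - dfun mu (x - e).
  rewrite -lte_fin -probability_ray; apply: Sx; first exact: interval_open.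
  by rewrite /= in_itv/= andbT gtrBl.
set a := dfun _ _ in a0; set b := dfun _ _ in b1.
move/ess_supP : Mc => /ae_distribution_comp[N [mN N0 NS]].
(* For 0 < t < t0, (1 - p)t < a puts Y1 at most y + e, and pt < 1 - b puts Y2 above x - e. Then Y2 -
   Y1 > c, so ]0, t0[ lies in the exceptional null set although its length t0 is positive. *)
pose t0 := Num.min 1 (Num.min a (1 - b)).
have t0_gt0 : 0 < t0 by rewrite !lt_min ltr01 a0 b1.
have : uniform_prob (@ltr01 R) `]0, t0[%classic = 0%E.
  apply: subset_measure0 N0 => // t /=; rewrite in_itv/= !lt_min.
  move=> /andP[t_gt0 /and3P[t1 ta tb]]; apply: NS => /=.
  have t01 : 0 < t < 1 by rewrite t_gt0.
  have /andP[pt0 _] := pt_itv t01.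
  have /andP[qt0 _] : 0 < (1 - p) * t < 1 by exact: left_level_itv.
  apply/negP; rewrite lee_fin -ltNge.
  have l1 : quantile mu ((1 - p) * t) <= y + e.
    by rewrite leNgt lt_quantile ?left_level_itv// -leNgt -/a; lra.
  have l2 : x - e < quantile mu (1 - p * t).
    by rewrite lt_quantile ?colliding_level_itv// -/b; lra.
  by move: l1 l2; rewrite /e; lra.
rewrite uniform_probE// (_ : _ `&` _ = `]0, t0[%classic); last first.
  apply/setIidPl; apply: subset_itvl.
  by rewrite bnd_simp ge_min lexx.
rewrite lebesgue_measure_itv/= lte_fin t0_gt0 sube0 => -[] t00.
by rewrite t00 ltxx in t0_gt0.
Qed.

Lemma diameter_le_colliding :
  (diameter (essential_support mu) <=
   max_variation (colliding_decomposition p mu))%E.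
Proof.
apply: ge_ereal_sup => _ [x Sx [y Sy <-]].
have [xy|xy] := leP y x.
  by rewrite ger0_norm ?subr_ge0//; exact: sub_le_max_variation_colliding.
rewrite distrC ger0_norm ?subr_ge0 ?(ltW xy)//.
exact: sub_le_max_variation_colliding.
Qed.

End pacman.

Theorem theorem2p3 (R : realType) (p : R) (p_gt0 : 0 < p) (p_lt1 : p < 1)
    (mu : probability (measurableTypeR R) R) :
  (bernoulli_decomposition p mu (chasing_decomposition p mu) /\
   (forall rho : probability (measurableTypeR R * measurableTypeR R)%type R,
      bernoulli_decomposition p mu rho ->
      (min_variation rho <= beta_plus p mu)%E) /\
   beta_plus p mu = min_variation (chasing_decomposition p mu) /\
   beta_plus p mu =
     ereal_inf [set (delta_plus p mu t)%:E | t in [set t : R | 0 < t < 1]]) /\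
  (bernoulli_decomposition p mu (colliding_decomposition p mu) /\
   (forall rho : probability (measurableTypeR R * measurableTypeR R)%type R,
      bernoulli_decomposition p mu rho ->
      (max_variation rho <= max_variation (colliding_decomposition p mu))%E) /\
   max_variation (colliding_decomposition p mu) =
     diameter (essential_support mu)).
Proof.
have chB := chasing_bernoulli p_gt0 p_lt1 mu.
have coB := colliding_bernoulli p_gt0 p_lt1 mu.
have rho_inf rho : bernoulli_decomposition p mu rho ->
    (min_variation rho <=
     ereal_inf [set (delta_plus p mu t)%:E | t in
       [set t : R | (0 < t < 1)%R]])%E.
  move=> rhoB; apply: le_ereal_inf_tmp => _ [t t01 <-].
  exact: min_variation_le_delta.
have inf_beta := inf_delta_le_beta_plus p mu.
have beta_ch := beta_plus_le_chasing p mu.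
have diam_co := diameter_le_colliding p_gt0 p_lt1 mu.
split; split => //; split.
- by move=> rho /rho_inf /le_trans; apply.
(* Both equalities follow by applying [rho_inf] to the chasing law itself. *)
- split; apply/eqP; rewrite eq_le.
  + by rewrite beta_ch (le_trans (rho_inf _ chB)).
  + by rewrite inf_beta andbT (le_trans beta_ch)// rho_inf.
- move=> rho /(max_variation_le_diameter p_gt0 p_lt1) /le_trans; exact.
- apply/eqP; rewrite eq_le diam_co andbT.
  exact: max_variation_le_diameter coB.
Qed.
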